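(* Let $\alpha,\beta\in(1,2)$ and let $d,e$ be nonnegative functions on $\Omega=(x_L,x_R)\times(y_L,y_R)$. Let $u(x,y,t)$ be the exact solution, assumed smooth enough, of $$\frac{\partial u}{\partial t}=d(x,y)\,{}_{x_L}D_x^{\alpha}u+e(x,y)\,{}_{y_L}D_y^{\beta}u+f(x,y,t),\quad (x,y)\in\Omega,\ t\in(0,T],$$ with $u=0$ on $\partial\Omega\times[0,T]$ and $u(x,y,0)=\varphi(x,y)$ on $\bar\Omega$; here smooth enough means that there is a constant $c_3>0$ independent of $i,j,n,\tau,h_1,h_2$ such that the truncation errors $\hat R_{i,j}^{n-\frac12}$ of the scheme satisfy $|\hat R_{i,j}^{n-\frac12}|\le c_3(\tau^2+h_1^2+h_2^2)$ for $1\le i\le M_1$, $1\le j\le M_2$, $1\le n\le N$. Let $u_{i,j}^n$ be the solution of the finite difference scheme $$\frac1{\tau}\left(u^{n}-u^{n-1}\right)=\left(\frac{1}{2h_1^\alpha}D(I\otimes G_\alpha)+\frac{1}{2h_2^\beta}E(G_\beta\otimes I)\right)\left(u^{n-1}+u^{n}\right)+f^{n-\frac12},\qquad 1\le n\le N,$$ with $u_{i,j}^0=\varphi(x_i,y_j)$ and zero boundary values, and let $e_{i,j}^n=u(x_i,y_j,t_n)-u_{i,j}^n$, $0\le i\le M_1+1$, $0\le j\le M_2+1$, $0\le n\le N$, with $e^n$ the vector of the interior values. Then, for any $Q\in\mathfrak{D}$, there exists a positive constant $c_4$, independent of $\tau,h_1,h_2,n$, such that $$\|e^n\|\le c_4(\tau^2+h_1^2+h_2^2),\qquad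 0\le n\le N.$$
   Context: Let $T>0$, $M_1,M_2,N$ positive integers, $\tau=T/N$, $h_1=\frac{x_R-x_L}{M_1+1}$, $h_2=\frac{y_R-y_L}{M_2+1}$, $x_i=x_L+ih_1$, $y_j=y_L+jh_2$, $t_n=n\tau$, $t_{n-\frac12}=(t_{n-1}+t_n)/2$. The Riemann–Liouville derivative is ${}_{x_L}D_x^{\alpha}u(x,y,t)=\frac{1}{\Gamma(2-\alpha)}\frac{\partial^2}{\partial x^2}\int_{x_L}^x\frac{u(\xi,y,t)}{(x-\xi)^{\alpha-1}}d\xi$, and ${}_{y_L}D_y^{\beta}$ is defined similarly in $y$. Vectors of interior grid values are ordered with the $x$-index running fastest: $u^n=(u^n_{1,1},\dots,u^n_{M_1,1},u^n_{1,2},\dots,u^n_{M_1,M_2})^T$, and likewise $f^{n-\frac12}$ has entries $f(x_i,y_j,t_{n-\frac12})$. $D$ and $E$ are the diagonal matrices with diagonal entries $d_{i,j}=d(x_i,y_j)$ and $e(x_i,y_j)$ in the same order. For $\gamma\in(1,2)$ define $g_0^{(\gamma)}=1$, $g_k^{(\gamma)}=\left(1-\frac{\gamma+1}{k}\right)g_{k-1}^{(\gamma)}$ $(k\ge1)$, $w_0^{(\gamma)}=\frac{\gamma}{2}g_0^{(\gamma)}$, $w_k^{(\gamma)}=\frac{\gamma}{2}g_k^{(\gamma)}+\frac{2-\gamma}{2}g_{k-1}^{(\gamma)}$ $(k\ge1)$. $G_\gamma$ is the Toeplitz matrix with $(i,j)$ entry $w_{i-j+1}^{(\gamma)}$ if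 $i-j+1\ge0$ and $0$ otherwise; $G_\alpha$ has size $M_1\times M_1$ and $G_\beta$ has size $M_2\times M_2$. $\otimes$ is the Kronecker product and $I$ an identity matrix of the appropriate size ($M_2$ in $I\otimes G_\alpha$, $M_1$ in $G_\beta\otimes I$). The truncation errors are defined, with $U_{i,j}^n=u(x_i,y_j,t_n)$, by $$\hat R_{i,j}^{n-\frac12}=\frac{U_{i,j}^{n}-U_{i,j}^{n-1}}{\tau}-\frac{d(x_i,y_j)}{2h_1^{\alpha}}\sum_{k=0}^{i}w_{k}^{(\alpha)}\left(U_{i-k+1,j}^{n-1}+U_{i-k+1,j}^{n}\right)-\frac{e(x_i,y_j)}{2h_2^{\beta}}\sum_{k=0}^{j}w_{k}^{(\beta)}\left(U_{i,j-k+1}^{n-1}+U_{i,j-k+1}^{n}\right)-f(x_i,y_j,t_{n-\frac12}).$$ Put $A=\frac{1}{2h_1^\alpha}D(I\otimes G_\alpha)+\frac{1}{2h_2^\beta}E(G_\beta\otimes I)$ and, for a square matrix $X$, let $\mathcal{H}(X)=(X+X^T)/2$. $\mathfrak{D}$ is the set of (real symmetric) matrices $X$, understood as families depending on the discretization, such that $X$ is positive definite, $-\mathcal{H}(XA)$ is positive semidefinite, and $\mathrm{cond}(X)=\|X\|_2\|X^{-1}\|_2\le c$ for a constant $c$ independent of $\tau,h_1,h_2$. The discrete $L^2$ norm is $\|v\|=\sqrt{h_1h_2\,v^Tv}$. *)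

(* Defs.v *)
From HB Require Import structures.
From mathcomp Require Import all_boot all_order all_algebra.
From mathcomp Require Import all_classical all_reals all_analysis.
From mathcomp Require Import mxtens.
Set Implicit Arguments.
Unset Strict Implicit.
Unset Printing Implicit Defensive.
Import Order.TTheory GRing.Theory Num.Theory.
Import numFieldNormedType.Exports.
Local Open Scope classical_set_scope.
Local Open Scope ring_scope.

Record fde_data (R : realType) := FdeData {
  x_L : R; x_R : R; y_L : R; y_R : R;
  final_time : R;
  alpha : R; beta : R;
  d_coef : R -> R -> R;
  e_coef : R -> R -> R;
  source : R -> R -> R -> R;
  phi : R -> R -> R }.

Definition Omega (R : realType) (P : fde_data R) : set (R * R) :=
  `]x_L P, x_R P[ `*` `]y_L P, y_R P[.

Definition boundary (T : topologicalType) (S : set T) : set T :=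
  closure S `\` S°.

Definition Gamma (R : realType) (z : R) : R :=
  \int[lebesgue_measure]_(s in `]0, +oo[) (s `^ (z - 1) * expR (- s)).

Definition RL_kernel (R : realType) (gam : R) (v : R -> R) (x xi : R) : R :=
  v xi / (x - xi) `^ (gam - 1).

Definition RL_integral (R : realType) (a gam : R) (v : R -> R) (x : R) : R :=
  \int[lebesgue_measure]_(xi in `]a, x[) RL_kernel gam v x xi.

(* Riemann-Liouville derivative of order gam in (1, 2). *)
Definition RL_derive (R : realType) (a gam : R) (v : R -> R) (x : R) : R :=
  (Gamma (2 - gam))^-1 * derive1n 2 (RL_integral a gam v) x.

(* [RL_derive] is total; this says that it is not a default value at [x]. *)
Definition RL_derivable (R : realType) (a gam : R) (v : R -> R) (x : R) : Prop :=
  [/\ \forall z \near x, lebesgue_measure.-integrable `]a, z[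
                           (EFin \o RL_kernel gam v z),
      \forall z \near x, derivable (RL_integral a gam v) z 1 &
      derivable (derive1 (RL_integral a gam v)) x 1].

(* Derivative relative to [S]: one-sided at an endpoint of an interval. *)
Definition has_derivative_within (R : realType) (S : set R) (v : R -> R)
    (t l : R) : Prop :=
  (v s - v t) / (s - t) @[s --> within S t^'] --> l.

Definition exact_solution (R : realType) (P : fde_data R)
    (u : R -> R -> R -> R) : Prop :=
  [/\ forall x y t, Omega P (x, y) -> 0 < t <= final_time P ->
        [/\ RL_derivable (x_L P) (alpha P) (fun xi => u xi y t) x,
            RL_derivable (y_L P) (beta P) (fun eta => u x eta t) y &
            has_derivative_within `[0, final_time P] (u x y) t
              (d_coef P x y * RL_derive (x_L P) (alpha P) (fun xi => u xi y t) x
               + e_coef P x y * RL_derive (y_L P) (beta P) (fun eta => u x eta t) y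
               + source P x y t)],
      forall x y t, boundary (Omega P) (x, y) -> 0 <= t <= final_time P ->
        u x y t = 0 &
      forall x y, closure (Omega P) (x, y) -> u x y 0 = phi P x y].

Definition h1 (R : realType) (P : fde_data R) (M1 : nat) : R :=
  (x_R P - x_L P) / M1.+1%:R.
Definition h2 (R : realType) (P : fde_data R) (M2 : nat) : R :=
  (y_R P - y_L P) / M2.+1%:R.
Definition tau (R : realType) (P : fde_data R) (N : nat) : R :=
  final_time P / N%:R.

Definition xnode (R : realType) (P : fde_data R) (M1 i : nat) : R :=
  x_L P + i%:R * h1 P M1.
Definition ynode (R : realType) (P : fde_data R) (M2 j : nat) : R :=
  y_L P + j%:R * h2 P M2.
Definition tnode (R : realType) (P : fde_data R) (N n : nat) : R :=
  n%:R * tau P N.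

(* t_(n - 1/2), for n >= 1. *)
Definition tmid (R : realType) (P : fde_data R) (N n : nat) : R :=
  (tnode P N n.-1 + tnode P N n) / 2.

(* Vector of the values at the nodes (i, j), 1 <= i <= M1, 1 <= j <= M2.
   [mxtens_index (j, i)] is [j * M1 + i], so the x-index runs fastest. *)
Definition interior_vec (R : realType) (M1 M2 : nat) (v : nat -> nat -> R) :
    'cV[R]_(M2 * M1) :=
  \col_k v (mxtens_unindex k).2.+1 (mxtens_unindex k).1.+1.

Fixpoint g (R : realType) (gam : R) (k : nat) : R :=
  if k is k'.+1 then (1 - (gam + 1) / k%:R) * g gam k' else 1.

Definition w (R : realType) (gam : R) (k : nat) : R :=
  if k is k'.+1 then gam / 2 * g gam k + (2 - gam) / 2 * g gam k'
  else gam / 2 * g gam 0.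

Definition G (R : realType) (gam : R) (M : nat) : 'M[R]_M :=
  \matrix_(i, j) if (j <= i.+1)%N then w gam (i.+1 - j) else 0.

Definition grid_diag (R : realType) (P : fde_data R) (c : R -> R -> R)
    (M1 M2 : nat) : 'M[R]_(M2 * M1) :=
  diag_mx (interior_vec M1 M2 (fun i j => c (xnode P M1 i) (ynode P M2 j)))^T.

Definition A_mx (R : realType) (P : fde_data R) (M1 M2 : nat) :
    'M[R]_(M2 * M1) :=
  (2 * (h1 P M1 `^ alpha P))^-1 *:
    (grid_diag P (d_coef P) M1 M2 *m tensmx (1%:M : 'M[R]_M2) (G (alpha P) M1))
  + (2 * (h2 P M2 `^ beta P))^-1 *:
    (grid_diag P (e_coef P) M1 M2 *m tensmx (G (beta P) M2) (1%:M : 'M[R]_M1)).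

Definition source_mid (R : realType) (P : fde_data R) (M1 M2 N n : nat) :
    'cV[R]_(M2 * M1) :=
  interior_vec M1 M2
    (fun i j => source P (xnode P M1 i) (ynode P M2 j) (tmid P N n)).

(* The grid function is [v n i j], for time level n and node (i, j). *)
Definition scheme_solution (R : realType) (P : fde_data R) (M1 M2 N : nat)
    (v : nat -> nat -> nat -> R) : Prop :=
  [/\ forall n, (1 <= n <= N)%N ->
        (tau P N)^-1 *: (interior_vec M1 M2 (v n) - interior_vec M1 M2 (v n.-1))
        = A_mx P M1 M2 *m
            (interior_vec M1 M2 (v n.-1) + interior_vec M1 M2 (v n))
          + source_mid P M1 M2 N n,
      forall i j, (1 <= i <= M1)%N -> (1 <= j <= M2)%N ->
        v 0%N i j = phi P (xnode P M1 i) (ynode P M2 j) &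
      forall n i j, (n <= N)%N -> (i <= M1.+1)%N -> (j <= M2.+1)%N ->
        [|| i == 0%N, i == M1.+1, j == 0%N | j == M2.+1] -> v n i j = 0].

(* Used only for n >= 1 and 1 <= i, 1 <= j; [(i - k).+1] is i - k + 1 since
   k <= i in the sum. *)
Definition truncation_error (R : realType) (P : fde_data R)
    (u : R -> R -> R -> R) (M1 M2 N i j n : nat) : R :=
  let U m i' j' := u (xnode P M1 i') (ynode P M2 j') (tnode P N m) in
  let x := xnode P M1 i in
  let y := ynode P M2 j in
  (U n i j - U n.-1 i j) / tau P N
  - d_coef P x y / (2 * (h1 P M1 `^ alpha P)) *
      (\sum_(0 <= k < i.+1)
         w (alpha P) k * (U n.-1 (i - k).+1 j + U n (i - k).+1 j))
  - e_coef P x y / (2 * (h2 P M2 `^ beta P)) *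
      (\sum_(0 <= k < j.+1)
         w (beta P) k * (U n.-1 i (j - k).+1 + U n i (j - k).+1))
  - source P x y (tmid P N n).

Definition smooth_enough (R : realType) (P : fde_data R)
    (u : R -> R -> R -> R) : Prop :=
  exists2 c3 : R, 0 < c3 &
    forall M1 M2 N i j n : nat, (0 < M1)%N -> (0 < M2)%N -> (0 < N)%N ->
      (1 <= i <= M1)%N -> (1 <= j <= M2)%N -> (1 <= n <= N)%N ->
      `|truncation_error P u M1 M2 N i j n|
        <= c3 * (tau P N ^+ 2 + h1 P M1 ^+ 2 + h2 P M2 ^+ 2).

Definition error_vec (R : realType) (P : fde_data R) (u : R -> R -> R -> R)
    (M1 M2 N : nat) (v : nat -> nat -> nat -> R) (n : nat) :
    'cV[R]_(M2 * M1) :=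
  interior_vec M1 M2
    (fun i j => u (xnode P M1 i) (ynode P M2 j) (tnode P N n) - v n i j).

Definition discrete_norm (R : realType) (P : fde_data R) (M1 M2 : nat)
    (v : 'cV[R]_(M2 * M1)) : R :=
  Num.sqrt (h1 P M1 * h2 P M2 * (v^T *m v) 0 0).

Definition sym_part (R : realType) (n : nat) (X : 'M[R]_n) : 'M[R]_n :=
  2^-1 *: (X + X^T).

Definition posdef (R : realType) (n : nat) (X : 'M[R]_n) : Prop :=
  X^T = X /\ forall v : 'cV[R]_n, v != 0 -> 0 < (v^T *m X *m v) 0 0.

Definition possemidef (R : realType) (n : nat) (X : 'M[R]_n) : Prop :=
  X^T = X /\ forall v : 'cV[R]_n, 0 <= (v^T *m X *m v) 0 0.

Definition vnorm2 (R : realType) (n : nat) (v : 'cV[R]_n) : R :=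
  Num.sqrt ((v^T *m v) 0 0).

Definition mxnorm2 (R : realType) (n : nat) (X : 'M[R]_n) : R :=
  sup [set vnorm2 (X *m v) | v in [set v : 'cV[R]_n | vnorm2 v <= 1]].

Definition cond2 (R : realType) (n : nat) (X : 'M[R]_n) : R :=
  mxnorm2 X * mxnorm2 (invmx X).

(* Families of matrices indexed by the discretization (M1, M2, N). *)
Definition in_frakD (R : realType) (P : fde_data R)
    (X : forall M1 M2 N : nat, 'M[R]_(M2 * M1)) : Prop :=
  exists c : R, forall M1 M2 N : nat, (0 < M1)%N -> (0 < M2)%N -> (0 < N)%N ->
    [/\ posdef (X M1 M2 N),
        possemidef (- sym_part (X M1 M2 N *m A_mx P M1 M2)) &
        cond2 (X M1 M2 N) <= c].

(* Main.v *)
Require Import Defs.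
From mathcomp Require Import all_boot all_order all_algebra.
From mathcomp Require Import all_classical all_reals all_analysis.
From mathcomp Require Import mxtens ring lra.
Set Implicit Arguments.
Unset Strict Implicit.
Unset Printing Implicit Defensive.
Import Order.TTheory GRing.Theory Num.Theory.
Import numFieldNormedType.Exports.
Local Open Scope classical_set_scope.
Local Open Scope ring_scope.

(** Consistency plus stability gives convergence, and stability is an energy
    estimate in the norm |v|_Q = sqrt (v^T Q v).

    Subtracting the scheme from the same relation for the grid values of the
    exact solution, the errors satisfy
      (e_n - e_(n-1)) / tau = A (e_(n-1) + e_n) + r_n
    with r_n the vector of truncation errors ([error_vec_scheme]).  Here the
    boundary values matter: row i = M1 of the convolution sum involves the value
    at x_R, which the matrix A drops and which is zero for the exact solution.

    Pairing with Q (e_(n-1) + e_n), the left side becomes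
    (|e_n|_Q^2 - |e_(n-1)|_Q^2) / tau by symmetry of Q, the A term is
    nonpositive because only the symmetric part of Q A enters a quadratic form,
    and Cauchy-Schwarz bounds the r_n term by
    (|e_(n-1)|_Q + |e_n|_Q) |r_n|_Q.  Cancelling the common factor gives
    |e_n|_Q <= |e_(n-1)|_Q + tau |r_n|_Q ([qnorm_step]), and as e_0 = 0 the
    error after n steps is at most n tau <= T times the largest |r_n|_Q.

    Passing to and from the Euclidean norm costs the factor sqrt (cond Q)
    ([vnorm2_stability]), which is bounded uniformly in the grid.  Finally the
    M1 M2 entries of r_n are each at most c_3 (tau^2 + h_1^2 + h_2^2), and the
    weight h_1 h_2 M1 M2 is at most the area of the domain ([cell_area_le]). *)

(** * Quadratic forms and the norms they define *)

Definition bform {R : realType} {n : nat} (X : 'M[R]_n) (v z : 'cV[R]_n) : R :=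
  (v^T *m X *m z) 0 0.

Definition qnorm {R : realType} {n : nat} (X : 'M[R]_n) (v : 'cV[R]_n) : R :=
  Num.sqrt (bform X v v).

Lemma bformDl {R : realType} {n} (X : 'M[R]_n) v1 v2 z :
  bform X (v1 + v2) z = bform X v1 z + bform X v2 z.
Proof. by rewrite /bform linearD /= !mulmxDl mxE. Qed.

Lemma bformDr {R : realType} {n} (X : 'M[R]_n) v z1 z2 :
  bform X v (z1 + z2) = bform X v z1 + bform X v z2.
Proof. by rewrite /bform mulmxDr mxE. Qed.

Lemma bformZl {R : realType} {n} (X : 'M[R]_n) a v z :
  bform X (a *: v) z = a * bform X v z.
Proof. by rewrite /bform linearZ /= -!scalemxAl mxE. Qed.

Lemma bformZr {R : realType} {n} (X : 'M[R]_n) a v z :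
  bform X v (a *: z) = a * bform X v z.
Proof. by rewrite /bform -!scalemxAr mxE. Qed.

Lemma bform_tr {R : realType} {n} (X : 'M[R]_n) v z :
  bform X^T v z = bform X z v.
Proof.
have tr11 (M : 'M[R]_1) : M^T 0 0 = M 0 0 by rewrite mxE.
by rewrite /bform -[RHS]tr11 !trmx_mul trmxK mulmxA.
Qed.

Lemma bform_mull {R : realType} {n} (X Y : 'M[R]_n) v z :
  bform (X *m Y) v z = bform X v (Y *m z).
Proof. by rewrite /bform !mulmxA. Qed.

Lemma bform1 {R : realType} {n} (v : 'cV[R]_n) :
  bform 1%:M v v = \sum_i v i 0 ^+ 2.
Proof.
by rewrite /bform mulmx1 mxE; apply: eq_bigr => i _; rewrite mxE expr2.
Qed.

Lemma vnorm2E {R : realType} {n} (v : 'cV[R]_n) : vnorm2 v = qnorm 1%:M v.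
Proof. by rewrite /qnorm /bform mulmx1. Qed.

Lemma posdef_possemidef {R : realType} {n} (X : 'M[R]_n) :
  posdef X -> possemidef X.
Proof.
case=> XT Xpos; split=> // v; have [->|v0] := eqVneq v 0.
  by rewrite mulmx0 mxE.
exact/ltW/Xpos.
Qed.

Lemma possemidef1 {R : realType} {n} : possemidef (1%:M : 'M[R]_n).
Proof.
split=> [|v]; first exact: trmx1.
by rewrite -/(bform _ v v) bform1 sumr_ge0 // => i _; exact: sqr_ge0.
Qed.

Lemma posdef_unitmx {R : realType} {n} (X : 'M[R]_n) : posdef X -> X \in unitmx.
Proof.
case=> _ Xpos; rewrite unitmxE unitfE; apply/det0P => -[v v0 vX].
have := Xpos v^T; rewrite trmxK vX mul0mx mxE ltxx => /(_ _)/negP.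
by apply=> //; rewrite -trmx0 (inj_eq trmx_inj).
Qed.

Section semidefinite.
Context {R : realType} {n : nat} {X : 'M[R]_n} (Xpsd : possemidef X).

Lemma bformC v z : bform X v z = bform X z v.
Proof. by rewrite -[in LHS](proj1 Xpsd) bform_tr. Qed.

Lemma bform_ge0 v : 0 <= bform X v v.
Proof. exact: (proj2 Xpsd). Qed.

Lemma qnorm_ge0 v : 0 <= qnorm X v.
Proof. exact: sqrtr_ge0. Qed.

Lemma sqr_qnorm v : qnorm X v ^+ 2 = bform X v v.
Proof. by rewrite sqr_sqrtr // bform_ge0. Qed.

(** Cauchy-Schwarz.  It is stated for semidefinite matrices since the
    degenerate case takes only one more instance of the positivity of the form. *)
Lemma bform_sqr_le v z : bform X v z ^+ 2 <= bform X v v * bform X z z.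
Proof.
have pos s t : 0 <= s ^+ 2 * bform X v v + 2 * (s * t) * bform X v z
                   + t ^+ 2 * bform X z z.
  have := bform_ge0 (s *: v + t *: z).
  rewrite !bformDl !bformDr !bformZl !bformZr (bformC z v).
  by congr (0 <= _); ring.
have v0 := bform_ge0 v; have z0 := bform_ge0 z.
move: (bform X v v) (bform X v z) (bform X z z) pos v0 z0 => a b c pos a0 c0.
have [c_gt0|] := ltP 0 c.
  (* The minimizer of the form on the line through v along z, scaled by c. *)
  have := pos c (- b).
  rewrite (_ : _ + _ = c * (a * c - b ^+ 2)); last by ring.
  by rewrite pmulr_rge0 // subr_ge0.
move=> c_le0; have {c0 c_le0} c0 : c = 0 by apply/eqP; rewrite eq_le c_le0 c0.
(* With c = 0 the form is a s^2 + 2 b s t; this choice of s and t makes it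
   - (a + 2) b^2, which forces b = 0. *)
have := pos b (- (a + 1)); rewrite c0 mulr0 addr0 => H.
have := sqr_ge0 b; nra.
Qed.

Lemma bform_le_qnorm v z : bform X v z <= qnorm X v * qnorm X z.
Proof.
rewrite (le_trans (ler_norm _)) // -sqrtr_sqr /qnorm -sqrtrM ?bform_ge0 //.
by rewrite ler_wsqrtr // bform_sqr_le.
Qed.

Lemma ler_qnormD v z : qnorm X (v + z) <= qnorm X v + qnorm X z.
Proof.
rewrite -(@ler_pXn2r _ 2) ?nnegrE ?addr_ge0 ?qnorm_ge0 //.
rewrite sqrrD !sqr_qnorm bformDl !bformDr (bformC z v).
have := bform_le_qnorm v z; lra.
Qed.

End semidefinite.

(** * The spectral norm and the condition number *)

Lemma vnorm2_ge0 {R : realType} {n} (v : 'cV[R]_n) : 0 <= vnorm2 v.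
Proof. exact: sqrtr_ge0. Qed.

Lemma vnorm2Z {R : realType} {n} (a : R) (v : 'cV[R]_n) :
  vnorm2 (a *: v) = `|a| * vnorm2 v.
Proof.
rewrite !vnorm2E /qnorm bformZl bformZr mulrA -expr2 sqrtrM ?sqr_ge0 //.
by rewrite sqrtr_sqr.
Qed.

Lemma vnorm2_eq0 {R : realType} {n} (v : 'cV[R]_n) : vnorm2 v = 0 -> v = 0.
Proof.
move=> v0; apply/colP => i; rewrite mxE; apply/eqP.
rewrite -sqrf_eq0 eq_le sqr_ge0 andbT.
have <- : vnorm2 v ^+ 2 = 0 by rewrite v0 expr0n.
rewrite vnorm2E (sqr_qnorm possemidef1) bform1 (bigD1 i) //= lerDl.
by rewrite sumr_ge0 // => j _; exact: sqr_ge0.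
Qed.

(** Without an upper bound the supremum [mxnorm2 X] would be a default value;
    the Frobenius norm of X provides one, by Cauchy-Schwarz on each row. *)
Lemma vnorm2_mulmx_bounded {R : realType} {n} (X : 'M[R]_n) :
  has_ubound [set vnorm2 (X *m v) | v in [set v : 'cV[R]_n | vnorm2 v <= 1]].
Proof.
exists (Num.sqrt (\sum_i vnorm2 (row i X)^T ^+ 2)) => _ [v /= v1 <-].
rewrite {1}vnorm2E /qnorm ler_wsqrtr // bform1 ler_sum // => i _.
have -> : (X *m v) i 0 = bform 1%:M (row i X)^T v.
  by rewrite /bform mulmx1 trmxK -row_mul [RHS]mxE.
apply: le_trans (bform_sqr_le possemidef1 _ _) _.
rewrite -!(sqr_qnorm possemidef1) -!vnorm2E ler_piMr ?sqr_ge0 //.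
by rewrite expr_le1 // vnorm2_ge0.
Qed.

Lemma mxnorm2_ge0 {R : realType} {n} (X : 'M[R]_n) : 0 <= mxnorm2 X.
Proof.
apply: ub_le_sup (vnorm2_mulmx_bounded X) _ _.
by exists 0; rewrite /= ?mulmx0 /vnorm2 mulmx0 mxE sqrtr0.
Qed.

Lemma vnorm2_mulmx_le {R : realType} {n} (X : 'M[R]_n) (v : 'cV[R]_n) :
  vnorm2 (X *m v) <= mxnorm2 X * vnorm2 v.
Proof.
have [v0|v0] := eqVneq (vnorm2 v) 0.
  by rewrite v0 mulr0 (vnorm2_eq0 v0) mulmx0 /vnorm2 mulmx0 mxE sqrtr0.
have v_gt0 : 0 < vnorm2 v by rewrite lt_def v0 vnorm2_ge0.
rewrite -ler_pdivrMr // mulrC -{1}(ger0_norm (vnorm2_ge0 v)) -normfV -vnorm2Z.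
rewrite scalemxAr; apply: ub_le_sup (vnorm2_mulmx_bounded X) _ _.
exists ((vnorm2 v)^-1 *: v); rewrite //= vnorm2Z normfV.
by rewrite ger0_norm ?vnorm2_ge0 // mulVf.
Qed.

Lemma qnorm_sqr_le_vnorm2 {R : realType} {n} (X : 'M[R]_n) (v : 'cV[R]_n) :
  possemidef X -> qnorm X v ^+ 2 <= mxnorm2 X * vnorm2 v ^+ 2.
Proof.
move=> Xpsd; rewrite (sqr_qnorm Xpsd) -[X in bform X]mul1mx bform_mull.
apply: le_trans (bform_le_qnorm possemidef1 _ _) _.
rewrite -!vnorm2E mulrC expr2 mulrA ler_wpM2r ?vnorm2_ge0 //.
exact: vnorm2_mulmx_le.
Qed.

(** The smallest eigenvalue of X is 1 / mxnorm2 (invmx X).  Instead of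
    diagonalizing, apply Cauchy-Schwarz for the form X to v and z = X^-1 v: then
    |v|^2 = <v, z>_X, while <z, z>_X = <v, X^-1 v> is at most
    mxnorm2 (invmx X) |v|^2. *)
Lemma vnorm2_sqr_le_qnorm {R : realType} {n} (X : 'M[R]_n) (v : 'cV[R]_n) :
  posdef X -> vnorm2 v ^+ 2 <= mxnorm2 (invmx X) * qnorm X v ^+ 2.
Proof.
move=> Xpd; have Xpsd := posdef_possemidef Xpd; have XU := posdef_unitmx Xpd.
set z := invmx X *m v.
have vE : vnorm2 v ^+ 2 = bform X v z.
  by rewrite vnorm2E (sqr_qnorm possemidef1) -bform_mull mulmxV.
have zE : qnorm X z ^+ 2 = bform 1%:M v z.
  rewrite (sqr_qnorm Xpsd) -[X in bform X]mul1mx bform_mull /z mulKVmx //.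
  by rewrite (bformC possemidef1).
have zle : qnorm X z ^+ 2 <= mxnorm2 (invmx X) * vnorm2 v ^+ 2.
  rewrite zE; apply: le_trans (bform_le_qnorm possemidef1 _ _) _.
  rewrite -!vnorm2E mulrC expr2 mulrA ler_wpM2r ?vnorm2_ge0 //.
  exact: vnorm2_mulmx_le.
have [v0|v0] := eqVneq (vnorm2 v) 0.
  by rewrite v0 expr0n /= mulr_ge0 ?mxnorm2_ge0 ?sqr_ge0.
have v_gt0 : 0 < vnorm2 v ^+ 2 by rewrite exprn_gt0 // lt_def v0 vnorm2_ge0.
have : (vnorm2 v ^+ 2) ^+ 2 <= qnorm X v ^+ 2 * qnorm X z ^+ 2.
  by rewrite vE !(sqr_qnorm Xpsd); exact: bform_sqr_le.
move=> /le_trans /(_ (ler_wpM2l (sqr_ge0 _) zle)).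
by rewrite expr2 [leRHS]mulrCA [leRHS]mulrA ler_pM2r.
Qed.

(** * Stability of the Crank-Nicolson step *)

Lemma sym_part_nonpos {R : realType} {n} (Y : 'M[R]_n) (v : 'cV[R]_n) :
  possemidef (- sym_part Y) -> bform Y v v <= 0.
Proof.
move=> /bform_ge0 /(_ v).
have -> : bform (- sym_part Y) v v = - bform Y v v.
  rewrite -[- _]scaleN1r /sym_part scalerA /bform -scalemxAr -scalemxAl.
  rewrite mulmxDr mulmxDl mxE [X in _ * X]mxE -!/(bform _ v v) bform_tr.
  by field.
by rewrite oppr_ge0.
Qed.

(** Pairing the scheme with X (e + e') telescopes the energy on the left and
    makes the A term nonpositive, which leaves
    |e'|^2 - |e|^2 <= t (|e| + |e'|) |r|; the factor |e| + |e'| cancels. *)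
Lemma qnorm_step {R : realType} {n} (X A : 'M[R]_n) (t : R)
    (e e' r : 'cV[R]_n) :
  possemidef X -> possemidef (- sym_part (X *m A)) -> 0 < t ->
  t^-1 *: (e' - e) = A *m (e + e') + r ->
  qnorm X e' <= qnorm X e + t * qnorm X r.
Proof.
move=> Xpsd XA t_gt0 scheme.
have dE : e' - e = t *: (A *m (e + e') + r).
  by rewrite -scheme scalerA divff ?scale1r // gt_eqF.
have energy : qnorm X e' ^+ 2 - qnorm X e ^+ 2 = bform X (e + e') (e' - e).
  rewrite !(sqr_qnorm Xpsd) -(scaleN1r e) !bformDl !bformDr !bformZr.
  by rewrite (bformC Xpsd e' e); ring.
have le1 : qnorm X e' ^+ 2 - qnorm X e ^+ 2
             <= t * ((qnorm X e + qnorm X e') * qnorm X r).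
  rewrite energy dE bformZr ler_wpM2l ?(ltW t_gt0) // bformDr -bform_mull.
  rewrite -[leRHS]add0r lerD ?sym_part_nonpos //.
  apply: le_trans (bform_le_qnorm Xpsd _ _) _.
  by rewrite ler_wpM2r ?qnorm_ge0 // ler_qnormD.
have e0 := qnorm_ge0 e; have e'0 := qnorm_ge0 e'.
have r0 : 0 <= t * qnorm X r by rewrite mulr_ge0 ?qnorm_ge0 // ltW.
(* If |e| > 0 the common factor is positive; if |e| = 0 the bound reads
   |e'|^2 <= t |e'| |r|. *)
have [e_gt0|e_le0] := ltP 0 (qnorm X e); first by nra.
have eq0 : qnorm X e = 0 by apply: le_anti; rewrite e_le0 e0.
rewrite eq0 in e0 le1 *; nra.
Qed.

(** The recursion is run in the X-norm, where no constant multiplies the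
    previous error, so that the price sqrt (cond2 X) of changing norms is paid
    once and not at each step: sqrt (mxnorm2 X) on the residuals and
    sqrt (mxnorm2 (invmx X)) on the final error. *)
Lemma vnorm2_stability {R : realType} {n} (X A : 'M[R]_n) (t b : R) (N : nat)
    (e r : nat -> 'cV[R]_n) :
  posdef X -> possemidef (- sym_part (X *m A)) -> 0 < t -> e 0%N = 0 ->
  (forall k, (k < N)%N ->
     t^-1 *: (e k.+1 - e k) = A *m (e k + e k.+1) + r k.+1
     /\ vnorm2 (r k.+1) <= b) ->
  forall k, (k <= N)%N -> vnorm2 (e k) <= Num.sqrt (cond2 X) * (k%:R * t * b).
Proof.
move=> Xpd XA t_gt0 e0 scheme; have Xpsd := posdef_possemidef Xpd.
have qk k : (k <= N)%N ->
    qnorm X (e k) <= k%:R * t * (Num.sqrt (mxnorm2 X) * b).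
  elim: k => [_|k IHk kN].
    by rewrite e0 /qnorm /bform mulmx0 mxE sqrtr0 !mul0r.
  have [ek rk] := scheme k kN.
  apply: le_trans (qnorm_step Xpsd XA t_gt0 ek) _.
  rewrite -natr1 2!mulrDl mul1r lerD ?IHk ?(ltnW kN) //.
  rewrite ler_wpM2l ?(ltW t_gt0) //.
  apply: le_trans (ler_wpM2l (sqrtr_ge0 _) rk).
  rewrite -(ger0_norm (vnorm2_ge0 _)) -sqrtr_sqr -sqrtrM ?mxnorm2_ge0 //.
  rewrite -[leLHS](ger0_norm (qnorm_ge0 _)) -sqrtr_sqr ler_wsqrtr //.
  exact: qnorm_sqr_le_vnorm2.
move=> k kN; rewrite -[leLHS](ger0_norm (vnorm2_ge0 _)) -sqrtr_sqr.
apply: le_trans (ler_wsqrtr (vnorm2_sqr_le_qnorm _ Xpd)) _.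
rewrite sqrtrM ?mxnorm2_ge0 // sqrtr_sqr ger0_norm ?qnorm_ge0 //.
rewrite /cond2 sqrtrM ?mxnorm2_ge0 // [leRHS]mulrAC mulrC.
rewrite ler_wpM2r ?sqrtr_ge0 //.
by rewrite mulrCA; exact: qk.
Qed.

(** * The scheme matrix acting on grid functions *)

(** Matrix index i stands for the grid index i + 1.  In the last row the
    convolution sum has one term more than the matrix row, the boundary value
    F M.+1, whence the hypothesis. *)
Lemma G_convolution {R : realType} (gam : R) (M : nat) (F : nat -> R)
    (i : 'I_M) :
  F M.+1 = 0 ->
  \sum_(k < M) G gam M i k * F k.+1
    = \sum_(0 <= k < i.+2) w gam k * F (i.+1 - k).+1.
Proof.
move=> FM.
(* Both sides are sums of H over 0 <= k < M + 1: on the left after appending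
   the boundary term k = M, on the right after reversing the order of
   summation and restoring the range k > i + 1, where H vanishes. *)
pose H k := if (k <= i.+1)%N then w gam (i.+1 - k) * F k.+1 else 0.
transitivity (\sum_(0 <= k < M.+1) H k).
  rewrite big_nat_recr //= {2}/H FM mulr0 if_same addr0 big_mkord.
  by apply: eq_bigr => k _; rewrite mxE /H; case: ifP => // _; rewrite mul0r.
rewrite /H -big_mkcond [RHS]big_nat_rev /= add0n.
rewrite [RHS](big_nat_widen _ _ M.+1) ?ltnS ?ltn_ord //.
apply: eq_big => [k|k ki]; first by rewrite ltnS.
by rewrite subSS subKn.
Qed.

Lemma tensmx_interior_vec {R : realType} (M1 M2 : nat) (B : 'M[R]_M2)
    (C : 'M[R]_M1) (V : nat -> nat -> R) (j : 'I_M2) (i : 'I_M1) :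
  (tensmx B C *m interior_vec M1 M2 V) (mxtens_index (j, i)) 0
    = \sum_(l < M2) \sum_(k < M1) B j l * C i k * V k.+1 l.+1.
Proof.
rewrite mxE pair_bigA /=.
rewrite (reindex (@mxtens_index M2 M1)) /=; last first.
  exists (@mxtens_unindex M2 M1) => k _; first exact: mxtens_indexK.
  exact: mxtens_unindexK.
by apply: eq_bigr => -[l k] _; rewrite tensmxE mxE mxtens_indexK.
Qed.

Lemma grid_diag_mulmx {R : realType} (P : fde_data R) (c : R -> R -> R)
    (M1 M2 : nat) (W : 'cV[R]_(M2 * M1)) (j : 'I_M2) (i : 'I_M1) :
  (grid_diag P c M1 M2 *m W) (mxtens_index (j, i)) 0
    = c (xnode P M1 i.+1) (ynode P M2 j.+1) * W (mxtens_index (j, i)) 0.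
Proof. by rewrite /grid_diag mul_diag_mx !mxE mxtens_indexK. Qed.

Lemma A_mx_interior_vec {R : realType} (P : fde_data R) (M1 M2 : nat)
    (V : nat -> nat -> R) :
  (forall j, (0 < j <= M2)%N -> V M1.+1 j = 0) ->
  (forall i, (0 < i <= M1)%N -> V i M2.+1 = 0) ->
  A_mx P M1 M2 *m interior_vec M1 M2 V =
  interior_vec M1 M2 (fun i j =>
    let x := xnode P M1 i in let y := ynode P M2 j in
    d_coef P x y / (2 * (h1 P M1 `^ alpha P)) *
      (\sum_(0 <= k < i.+1) w (alpha P) k * V (i - k).+1 j)
    + e_coef P x y / (2 * (h2 P M2 `^ beta P)) *
      (\sum_(0 <= k < j.+1) w (beta P) k * V i (j - k).+1)).
Proof.
move=> Vx Vy; apply/colP => k; rewrite -(mxtens_unindexK k).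
case: (mxtens_unindex k) => j i {k}.
rewrite mulmxDl -!scalemxAl -!mulmxA mxE [RHS]mxE mxtens_indexK /=.
rewrite mxE [X in _ + X = _]mxE !grid_diag_mulmx !tensmx_interior_vec.
rewrite -(@G_convolution _ _ M1 (fun i' => V i' j.+1)); last by rewrite Vx /=.
rewrite -(@G_convolution _ _ M2 (fun j' => V i.+1 j')); last by rewrite Vy /=.
rewrite mulrA [_^-1 * _]mulrC; congr (_ * _ + _).
  rewrite (bigD1 j) //= [X in _ + X]big1 => [|l /negPf lj]; last first.
    by rewrite big1 // => k _; rewrite mxE eq_sym lj !mul0r.
  by rewrite addr0; apply: eq_bigr => k _; rewrite mxE eqxx mul1r.
rewrite mulrA [_^-1 * _]mulrC; congr (_ * _); apply: eq_bigr => l _.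
rewrite (bigD1 i) //= [X in _ + X]big1 => [|k /negPf ki]; last first.
  by rewrite [1%:M _ _]mxE eq_sym ki mulr0 mul0r.
by rewrite addr0 [1%:M _ _]mxE eqxx mulr1.
Qed.

(** * The exact solution at the grid nodes *)

(** The segment from a point of the closed rectangle to the center lies in the
    open rectangle except perhaps for its starting point. *)
Lemma Omega_closure {R : realType} (P : fde_data R) (x y : R) :
  x_L P < x_R P -> y_L P < y_R P ->
  x_L P <= x <= x_R P -> y_L P <= y <= y_R P -> closure (Omega P) (x, y).
Proof.
move=> hx hy xin yin B Bxy.
pose p (s : R) : R * R := (x + s * ((x_L P + x_R P) / 2 - x),
                           y + s * ((y_L P + y_R P) / 2 - y)).
have aff (a b : R) : a + s * b @[s --> 0^'+] --> a.
  rewrite -[X in _ --> X]addr0 -[X in _ --> _ + X](mul0r b).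
  apply: cvgD; first exact: cvg_cst.
  apply: cvgM; last exact: cvg_cst.
  exact/cvg_at_right_filter/cvg_id.
have pB : \forall s \near 0^'+, B (p s) by exact: (cvg_pair (aff _ _) (aff _ _)).
near ((0 : R)^'+) => s.
have Bs : B (p s) by near: s; exact: pB.
have s0 : 0 < s by near: s; exact: nbhs_right_gt.
have s1 : s < 1 by near: s; exact: nbhs_right_lt.
by exists (p s); split=> //; split; rewrite /= in_itv /=; apply/andP; split; nra.
Unshelve. all: by end_near.
Qed.

Lemma Omega_boundary_right {R : realType} (P : fde_data R) (x y : R) :
  x_L P < x_R P -> y_L P < y_R P ->
  x_L P <= x <= x_R P -> y_L P <= y <= y_R P ->
  (x == x_R P) || (y == y_R P) -> boundary (Omega P) (x, y).
Proof.
move=> hx hy xin yin xy; split; first exact: Omega_closure.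
move=> /interior_subset [] /=; rewrite !in_itv /= => /andP[_ xR] /andP[_ yR].
by case/orP: xy => /eqP E; move: xR yR; rewrite E ltxx.
Qed.

Lemma node_itv {R : realType} (a b : R) (M i : nat) : a < b -> (i <= M.+1)%N ->
  a <= a + i%:R * ((b - a) / M.+1%:R) <= b.
Proof.
move=> ab iM; have M0 : 0 < M.+1%:R :> R by rewrite ltr0n.
rewrite lerDl mulr_ge0 ?divr_ge0 ?ler0n ?subr_ge0 ?(ltW ab) //=.
rewrite -lerBrDl mulrC -mulrA ler_piMr ?subr_ge0 ?(ltW ab) //.
by rewrite mulrC ler_pdivrMr // mul1r ler_nat.
Qed.

Lemma last_nodeE {R : realType} (a b : R) (M : nat) :
  a + M.+1%:R * ((b - a) / M.+1%:R) = b.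
Proof. by rewrite mulrC divfK ?pnatr_eq0 // addrC subrK. Qed.

Lemma tnode_itv {R : realType} (P : fde_data R) (N n : nat) :
  0 < final_time P -> (n <= N)%N -> 0 <= tnode P N n <= final_time P.
Proof.
move=> T0; case: N => [|N] nN.
  by move: nN; rewrite leqn0 => /eqP->; rewrite /tnode mul0r lexx ltW.
by have := node_itv T0 nN; rewrite add0r subr0.
Qed.

(** Only the nodes on the right and upper edges are considered: they are the
    boundary values which the convolution sums reach, while the lower and left
    ones have no weight in the scheme. *)
Lemma exact_solution_right_eq0 {R : realType} (P : fde_data R)
    (u : R -> R -> R -> R) (M1 M2 N n i j : nat) :
  0 < final_time P -> x_L P < x_R P -> y_L P < y_R P -> exact_solution P u ->
  (n <= N)%N -> (i <= M1.+1)%N -> (j <= M2.+1)%N ->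
  (i == M1.+1) || (j == M2.+1) ->
  u (xnode P M1 i) (ynode P M2 j) (tnode P N n) = 0.
Proof.
move=> hT hx hy [_ u_bd _] nN iM jM ij; apply: u_bd; last exact: tnode_itv.
apply: Omega_boundary_right => //; [exact: node_itv|exact: node_itv|].
by case/orP: ij => /eqP->; rewrite /xnode /ynode /h1 /h2 last_nodeE eqxx ?orbT.
Qed.

Lemma interior_vecD {R : realType} (M1 M2 : nat) (V W : nat -> nat -> R) :
  interior_vec M1 M2 V + interior_vec M1 M2 W
    = interior_vec M1 M2 (fun i j => V i j + W i j).
Proof. by apply/colP => k; rewrite !mxE. Qed.

(** * The error equation *)

Lemma exact_solution_scheme {R : realType} (P : fde_data R)
    (u : R -> R -> R -> R) (M1 M2 N n : nat) :
  0 < final_time P -> x_L P < x_R P -> y_L P < y_R P -> exact_solution P u ->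
  (n < N)%N ->
  let U m := interior_vec M1 M2
    (fun i j => u (xnode P M1 i) (ynode P M2 j) (tnode P N m)) in
  (tau P N)^-1 *: (U n.+1 - U n) = A_mx P M1 M2 *m (U n + U n.+1)
    + source_mid P M1 M2 N n.+1
    + interior_vec M1 M2 (fun i j => truncation_error P u M1 M2 N i j n.+1).
Proof.
move=> hT hx hy hu nN U; rewrite interior_vecD A_mx_interior_vec; first last.
- move=> i /andP[_ iM].
  by rewrite !(exact_solution_right_eq0 hT hx hy hu) ?addr0 ?eqxx ?orbT //
    ?(ltnW nN) // (leq_trans iM).
- move=> j /andP[_ jM].
  by rewrite !(exact_solution_right_eq0 hT hx hy hu) ?addr0 ?eqxx //
    ?(ltnW nN) // (leq_trans jM).
apply/colP => k; rewrite !mxE /truncation_error /=; ring.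
Qed.

Lemma error_vec_scheme {R : realType} (P : fde_data R)
    (u : R -> R -> R -> R) (M1 M2 N n : nat) (v : nat -> nat -> nat -> R) :
  0 < final_time P -> x_L P < x_R P -> y_L P < y_R P -> exact_solution P u ->
  scheme_solution P M1 M2 N v -> (n < N)%N ->
  let e := error_vec P u M1 M2 N v in
  (tau P N)^-1 *: (e n.+1 - e n) = A_mx P M1 M2 *m (e n + e n.+1)
    + interior_vec M1 M2 (fun i j => truncation_error P u M1 M2 N i j n.+1).
Proof.
move=> hT hx hy hu [hv _ _] nN e.
have Ue := exact_solution_scheme M1 M2 hT hx hy hu nN.
have /= ve := hv n.+1 nN.
pose U m := interior_vec M1 M2
  (fun i j => u (xnode P M1 i) (ynode P M2 j) (tnode P N m)).
pose V m := interior_vec M1 M2 (v m).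
have eE m : e m = U m - V m by apply/colP => k; rewrite !mxE.
rewrite !eE (_ : U n.+1 - _ - _ = (U n.+1 - U n) - (V n.+1 - V n)); last first.
  by apply/colP => k; rewrite !mxE; ring.
rewrite (_ : U n - _ + _ = (U n + U n.+1) - (V n + V n.+1)); last first.
  by apply/colP => k; rewrite !mxE; ring.
rewrite scalerBr mulmxBr {1}/U {1}/V Ue ve -/U -/V.
move: (_ *m (U n + U n.+1)) (_ *m (V n + V n.+1)) => AU AV.
apply/colP => k; rewrite !mxE; ring.
Qed.

(** * Discrete norms of grid functions *)

Lemma vnorm2_interior_vec_le {R : realType} (M1 M2 : nat) (V : nat -> nat -> R)
    (b : R) : 0 <= b ->
  (forall i j, (0 < i <= M1)%N -> (0 < j <= M2)%N -> `|V i j| <= b) ->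
  vnorm2 (interior_vec M1 M2 V) <= Num.sqrt (M2 * M1)%:R * b.
Proof.
move=> b0 Vb; rewrite -[b in leRHS](ger0_norm b0) -sqrtr_sqr -sqrtrM ?ler0n //.
rewrite vnorm2E /qnorm ler_wsqrtr // bform1.
have -> : (M2 * M1)%:R * b ^+ 2 = \sum_(k < M2 * M1) b ^+ 2.
  by rewrite sumr_const card_ord mulr_natl.
rewrite ler_sum // => k _; rewrite mxE -real_normK ?num_real //.
case: (mxtens_unindex k) => j i /=.
by apply: lerXn2r; rewrite ?nnegrE // Vb /= ?ltn_ord.
Qed.

Lemma discrete_normE {R : realType} (P : fde_data R) (M1 M2 : nat)
    (v : 'cV[R]_(M2 * M1)) : x_L P < x_R P -> y_L P < y_R P ->
  discrete_norm P v = Num.sqrt (h1 P M1 * h2 P M2) * vnorm2 v.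
Proof.
move=> hx hy; rewrite /discrete_norm sqrtrM // mulr_ge0 // divr_ge0 //.
all: by rewrite subr_ge0 ltW.
Qed.

Lemma cell_area_le {R : realType} (P : fde_data R) (M1 M2 : nat) :
  x_L P < x_R P -> y_L P < y_R P ->
  h1 P M1 * h2 P M2 * (M2 * M1)%:R <= (x_R P - x_L P) * (y_R P - y_L P).
Proof.
move=> hx hy.
have len (a b : R) (M : nat) : a < b -> 0 <= (b - a) / M.+1%:R * M%:R <= b - a.
  move=> ab; rewrite !mulr_ge0 ?invr_ge0 ?subr_ge0 ?(ltW ab) //=.
  rewrite -mulrA ler_piMr ?subr_ge0 ?(ltW ab) //.
  by rewrite mulrC ler_pdivrMr ?ltr0n // mul1r ler_nat.
have /andP[x0 xle] := len _ _ M1 hx; have /andP[y0 yle] := len _ _ M2 hy.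
by rewrite natrM [_%:R * _]mulrC mulrACA ler_pM.
Qed.

(** * Convergence *)

Theorem theorem3p2 (R : realType) (P : fde_data R) (u : R -> R -> R -> R)
  (hT : 0 < final_time P) (hx : x_L P < x_R P) (hy : y_L P < y_R P)
  (halpha : 1 < alpha P < 2) (hbeta : 1 < beta P < 2)
  (hd : forall x y, Omega P (x, y) -> 0 <= d_coef P x y)
  (he : forall x y, Omega P (x, y) -> 0 <= e_coef P x y)
  (hu : exact_solution P u) (hsmooth : smooth_enough P u)
  (Q : forall M1 M2 N : nat, 'M[R]_(M2 * M1)) (hQ : in_frakD P Q) :
  exists2 c4 : R, 0 < c4 &
    forall (M1 M2 N : nat) (v : nat -> nat -> nat -> R),
      (0 < M1)%N -> (0 < M2)%N -> (0 < N)%N ->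
      scheme_solution P M1 M2 N v ->
      forall n : nat, (n <= N)%N ->
        discrete_norm P (error_vec P u M1 M2 N v n)
          <= c4 * (tau P N ^+ 2 + h1 P M1 ^+ 2 + h2 P M2 ^+ 2).
Proof.
have [c3 c3_gt0 trunc] := hsmooth; have [c Qc] := hQ.
pose S := (x_R P - x_L P) * (y_R P - y_L P).
pose K := Num.sqrt c * final_time P * Num.sqrt S.
have K_ge0 : 0 <= K by rewrite !mulr_ge0 ?sqrtr_ge0 ?ltW.
(* K c3 bounds the error already, but K > 0 would rest on cond2 (Q M1 M2 N) >= 1;
   adding 1 gives a positive constant directly. *)
exists ((K + 1) * c3) => [|M1 M2 N v M1_gt0 M2_gt0 N_gt0 hv n nN].
  by rewrite mulr_gt0 // ltr_wpDl.
set eps := _ + h2 P M2 ^+ 2.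
have eps_ge0 : 0 <= eps by rewrite !addr_ge0 ?sqr_ge0.
have [Qpd QA Qcond] := Qc M1 M2 N M1_gt0 M2_gt0 N_gt0.
have tau_gt0 : 0 < tau P N by rewrite divr_gt0 // ltr0n.
pose r m := interior_vec M1 M2 (fun i j => truncation_error P u M1 M2 N i j m).
have e0 : error_vec P u M1 M2 N v 0 = 0.
  have [_ _ u_init] := hu; have [_ v_init _] := hv.
  apply/colP => k; rewrite !mxE /tnode mul0r.
  case: (mxtens_unindex k) => j i /=.
  rewrite v_init ?ltnS ?ltn_ord //= u_init ?subrr //.
  by apply: Omega_closure => //; apply: node_itv => //; rewrite ltnS ltnW.
pose b := Num.sqrt (M2 * M1)%:R * (c3 * eps).
have step k : (k < N)%N ->
    (tau P N)^-1 *: (error_vec P u M1 M2 N v k.+1 - error_vec P u M1 M2 N v k)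
      = A_mx P M1 M2 *m (error_vec P u M1 M2 N v k
                         + error_vec P u M1 M2 N v k.+1) + r k.+1
    /\ vnorm2 (r k.+1) <= b.
  move=> kN; split; first exact: error_vec_scheme.
  apply: vnorm2_interior_vec_le => [|i j iM jM].
    by rewrite mulr_ge0 // ltW.
  exact: trunc.
rewrite discrete_normE //.
have := vnorm2_stability Qpd QA tau_gt0 e0 step nN.
move=> /(ler_wpM2l (sqrtr_ge0 (h1 P M1 * h2 P M2))) /le_trans; apply.
have hh : 0 <= h1 P M1 * h2 P M2.
  by rewrite mulr_ge0 // divr_ge0 // subr_ge0 ltW.
rewrite /b.
rewrite [leLHS](_ : _ = Num.sqrt (cond2 (Q M1 M2 N)) * (n%:R * tau P N)
   * Num.sqrt (h1 P M1 * h2 P M2 * (M2 * M1)%:R) * (c3 * eps)); last first.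
  by rewrite (sqrtrM _ hh); ring.
rewrite -[leRHS]mulrA ler_wpM2r ?mulr_ge0 ?(ltW c3_gt0) //.
apply: le_trans (_ : K <= _); last by rewrite lerDl.
have /andP[t_ge0 t_le] := tnode_itv hT nN.
apply: ler_pM; rewrite ?mulr_ge0 ?sqrtr_ge0 ?ler_wsqrtr ?cell_area_le ?(ltW hT) //.
by apply: ler_pM; rewrite ?sqrtr_ge0 ?ler_wsqrtr.
Qed.
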